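(* Let $A, K \subseteq \mathbb{R}$ with $|K| \geq \aleph_0$. The following are equivalent: (1) $K$ is compact in $H(A)$. (2) $K$ is compact in the Euclidean topology, $K\setminus A$ is countable, and for every $x\in K\setminus A$ there exists $\varepsilon>0$ such that $(x-\varepsilon,x)\cap K=\emptyset$.
   Context: For $A\subseteq\mathbb{R}$, the Hattori space $H(A)$ is the set $\mathbb{R}$ with the topology $\tau(A)$ in which a point $x\in A$ has the local base $\{(x-\varepsilon,x+\varepsilon) : \varepsilon>0\}$ and a point $x\in\mathbb{R}\setminus A$ has the local base $\{[x,x+\varepsilon) : \varepsilon>0\}$. ''Countable'' means of cardinality at most $\aleph_0$. *)

(* Defs.v *)
From HB Require Import structures.
From mathcomp Require Import all_boot all_order all_algebra.
From mathcomp Require Import all_classical all_reals all_analysis.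
From mathcomp Require Import lra.
Import Order.TTheory GRing.Theory Num.Theory.
Import numFieldNormedType.Exports.

Set Implicit Arguments.
Unset Strict Implicit.
Unset Printing Implicit Defensive.

Local Open Scope classical_set_scope.
Local Open Scope ring_scope.

Definition hattori_base (R : realType) (A : set R) (x e : R) : set R :=
  if x \in A then [set` `]x - e, x + e[] else [set` `[x, x + e[].

(* An alias of R, so that it can carry a topology other than the Euclidean
   one: a set K : set R viewed in H(A) is written (K : set (hattori A)). *)
Definition hattori (R : realType) (A : set R) : Type := R.

Section HattoriTopology.
Variables (R : realType) (A : set R).
Implicit Types (x y e : R) (U : set R).

HB.instance Definition _ := Choice.copy (hattori A) R.

Definition hattori_nbhs (x : hattori A) : set_system (hattori A) :=
  [set U : set R | exists2 e : R, 0 < e & hattori_base A x e `<=` U].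

HB.instance Definition _ := hasNbhs.Build (hattori A) hattori_nbhs.

Lemma hattori_base_center x e : 0 < e -> hattori_base A x e x.
Proof.
by move=> e0; rewrite /hattori_base; case: ifP => _;
  rewrite /= in_itv /=; apply/andP; split; lra.
Qed.

Lemma le_hattori_base x e1 e2 :
  e1 <= e2 -> hattori_base A x e1 `<=` hattori_base A x e2.
Proof.
move=> e12 y; rewrite /hattori_base; case: ifP => _;
  by rewrite /= !in_itv /= => /andP[? ?]; apply/andP; split; lra.
Qed.

Lemma hattori_base_open x e y : hattori_base A x e y ->
  exists2 d, 0 < d & hattori_base A y d `<=` hattori_base A x e.
Proof.
move=> xey; case: (eqVneq y x) => [yx|yx].
  exists e; last by rewrite yx.
  by move: xey; rewrite yx /hattori_base; case: ifP => _;
    rewrite /= in_itv /= => /andP[]; lra.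
have [d d0 sub] : exists2 d, 0 < d & [set` `]y - d, y + d[] `<=` hattori_base A x e.
  move: xey; rewrite /hattori_base; case: ifP => _;
    rewrite /= in_itv /= => /andP[h1 h2].
  - exists (Num.min (y - (x - e)) (x + e - y)).
      by rewrite lt_min; apply/andP; split; lra.
    move=> z; rewrite /= !in_itv /= => /andP[].
    by case: (leP (y - (x - e)) (x + e - y)) => ? ? ?; apply/andP; split; lra.
  - have xy : x < y by rewrite lt_neqAle eq_sym yx.
    exists (Num.min (y - x) (x + e - y)).
      by rewrite lt_min; apply/andP; split; lra.
    move=> z; rewrite /= !in_itv /= => /andP[].
    by case: (leP (y - x) (x + e - y)) => ? ? ?; apply/andP; split; lra.
exists d => // z ydz; apply: sub; move: ydz; rewrite /hattori_base.
by case: ifP => _; rewrite /= !in_itv /= => /andP[? ?]; apply/andP; split; lra.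
Qed.

Let hattori_nbhs_filter (x : hattori A) : ProperFilter (nbhs x).
Proof.
apply: Build_ProperFilter_ex => [U [e e0 eU]|].
  by exists x; apply: eU; exact: hattori_base_center.
split.
- by exists 1.
- move=> U V [e e0 eU] [d d0 dV]; exists (Num.min e d).
    by rewrite lt_min e0.
  move=> y xy; split.
    by apply/eU/(le_hattori_base _ xy); rewrite ge_min lexx.
  by apply/dV/(le_hattori_base _ xy); rewrite ge_min lexx orbT.
- by move=> U V UV [e e0 eU]; exists e => //; exact: subset_trans UV.
Qed.

Let hattori_nbhs_singleton (x : hattori A) (U : set (hattori A)) :
  nbhs x U -> U x.
Proof. by move=> [e e0]; apply; exact: hattori_base_center. Qed.

Let hattori_nbhs_nbhs (x : hattori A) (U : set (hattori A)) :
  nbhs x U -> nbhs x (nbhs^~ U).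
Proof.
move=> [e e0 eU]; exists e => // y /hattori_base_open[d d0 dxe].
by exists d => //; exact: subset_trans eU.
Qed.

HB.instance Definition _ := Nbhs_isNbhsTopological.Build (hattori A)
  hattori_nbhs_filter hattori_nbhs_singleton hattori_nbhs_nbhs.

End HattoriTopology.

(* Main.v *)
(* Since the Hattori topology refines the Euclidean one, compactness passes down,
   and a point x of K \ A that K approaches from the left would give a filter on
   K clustering nowhere in H(A).  The left gaps (x - e, x) are then pairwise
   disjoint, so they are separated by rationals.  Conversely, for x in K \ A with
   a left gap, the traces on K of the Euclidean and Hattori neighbourhoods of x
   coincide, so Euclidean cluster points in K are Hattori cluster points. *)
Require Import Defs.
From mathcomp Require Import all_boot all_order all_algebra.
From mathcomp Require Import all_classical all_reals all_analysis.
From mathcomp Require Import lra.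
Import Order.TTheory GRing.Theory Num.Theory.
Import numFieldNormedType.Exports.

Local Open Scope classical_set_scope.
Local Open Scope ring_scope.

Lemma nbhs_hattori_nbhs (R : realType) (A : set R) (x : R) (U : set R) :
  nbhs x U -> nbhs (x : hattori A) (U : set (hattori A)).
Proof.
move=> /nbhs_ballP[e /= e0 eU]; exists e => // y xy; apply: eU.
rewrite /ball /= ltr_norml.
move: xy; rewrite /hattori_base; case: ifP => _; rewrite /= in_itv /= => /andP[? ?];
  by apply/andP; split; lra.
Qed.

Lemma hattori_compact_compact (R : realType) (A K : set R) :
  compact (K : set (hattori A)) -> compact (K : set R).
Proof.
move=> cK F PF FK; have [x [Kx clx]] := cK F PF FK.
by exists x; split=> // U V FU xV; apply: clx => //; exact: nbhs_hattori_nbhs.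
Qed.

(** Without a gap, the sets []x - e, x[] meeting [K] generate a proper filter on [K] that converges
    to [x] from the left. Only [x] could be a Euclidean cluster point, and [[x, x + 1[] rules it out
    because [x] is not in [A]. *)
Lemma hattori_compact_left_gap (R : realType) (A K : set R) (x : R) :
  compact (K : set (hattori A)) -> (K `\` A) x ->
  exists2 e : R, 0 < e & [set` `]x - e, x[] `&` K = set0.
Proof.
move=> cK [Kx nAx]; apply: contrapT => nogap.
have meet e : 0 < e -> [set` `]x - e, x[] `&` K !=set0.
  by move=> e0; apply/set0P/eqP => E; apply: nogap; exists e.
pose F : set_system (hattori A) :=
  [set U : set R | exists2 e : R, 0 < e & [set` `]x - e, x[] `&` K `<=` U].
have PF : ProperFilter F.
  apply: Build_ProperFilter_ex => [U [e e0 eU]|].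
    by have [y xy] := meet e e0; exists y; exact: eU.
  split.
  - by exists 1.
  - move=> U V [e e0 eU] [d d0 dV]; exists (Num.min e d); first by rewrite lt_min e0.
    move=> y [/=]; rewrite in_itv /= => /andP[yl yx] Ky.
    have [ye yd] : x - e < y /\ x - d < y by move: yl; case: (leP e d) => ? ?; split; lra.
    by split; [apply: eU|apply: dV]; split=> //=; rewrite in_itv /= ?ye ?yd.
  - by move=> U V UV [e e0 eU]; exists e => //; exact: subset_trans UV.
have FK : F K by exists 1 => // y [].
have [y [Ky cly]] := cK F PF FK.
have Fgap e : 0 < e -> F [set` `]x - e, x[] by move=> e0; exists e => // z [].
case: (ltP y x) => [yx|xy].
(* With half the distance as radius, the neighbourhood of [y] and the interval left of [x] lie on
   opposite sides of the midpoint. *)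
- have d0 : 0 < (x - y) / 2 by lra.
  have [|z []] := cly _ (hattori_base A y ((x - y) / 2)) (Fgap _ d0).
    by exists ((x - y) / 2).
  rewrite /hattori_base /= in_itv /= => /andP[? ?].
  by case: ifP => _; rewrite /= in_itv /= => /andP[? ?]; lra.
- have [d d0 dx] : exists2 d, 0 < d & forall z, hattori_base A y d z -> x <= z.
    case: (eqVneq x y) => [<-|nxy].
      exists 1 => // z; rewrite /hattori_base memNset //= in_itv /=.
      by case/andP.
    have {nxy}xy : x < y by rewrite lt_neqAle nxy.
    exists (y - x) => [|z]; first lra.
    by rewrite /hattori_base; case: ifP => _; rewrite /= in_itv /= => /andP[? ?]; lra.
  have [|z []] := cly _ (hattori_base A y d) (Fgap _ ltr01); first by exists d.
  by rewrite /= in_itv /= => /andP[? ?] /dx ?; lra.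
Qed.

(** A rational [q x] taken in the gap left of [x] exceeds every smaller point of [S]. So if [x < y]
    in [S], then [q x < x < q y], and [q] is injective on [S]. *)
Lemma left_isolated_countable (R : realType) (S : set R) :
  (forall x, S x -> exists2 e : R, 0 < e & [set` `]x - e, x[] `&` S = set0) ->
  countable S.
Proof.
move=> gap.
have /choice[q qP] : forall x, exists q : rat,
    S x -> ratr q < x /\ forall y, S y -> y < x -> y < ratr q.
  move=> x; have [Sx|nSx] := pselect (S x); last by exists 0.
  have [e e0 xe] := gap x Sx.
  have xex : x - e < x by lra.
  have [q] := rat_in_itvoo xex; rewrite in_itv /= => /andP[eq qx].
  exists q => _; split=> // y Sy yx; apply: le_lt_trans eq.
  rewrite leNgt; apply/negP => ey.
  suff : ([set` `]x - e, x[] `&` S) y by rewrite xe.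
  by split=> //=; rewrite in_itv /= ey.
apply/countable_injP; exists (pickle \o q).
move=> x y /set_mem Sx /set_mem Sy /(pcan_inj pickleK) qxy.
have [qx xP] := qP x Sx; have [qy yP] := qP y Sy.
case: (ltgtP x y) => // [xy|yx].
- by have := yP x Sx xy; rewrite -qxy => /(lt_trans qx); rewrite ltxx.
- by have := xP y Sy yx; rewrite qxy => /(lt_trans qy); rewrite ltxx.
Qed.

Lemma compact_left_gap_hattori_compact (R : realType) (A K : set R) :
  compact (K : set R) ->
  (forall x : R, (K `\` A) x ->
     exists2 e : R, 0 < e & [set` `]x - e, x[] `&` K = set0) ->
  compact (K : set (hattori A)).
Proof.
move=> cK gap F PF FK; have [x [Kx clx]] := cK F PF FK.
exists x; split=> // U V FU [e e0 eV].
have [d d0 dV] : exists2 d, 0 < d & ball x d `&` K `<=` hattori_base A x e.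
  rewrite /hattori_base; case: ifPn => [_|/negP nAx].
    exists e => // z [+ _]; rewrite /ball /= ltr_norml in_itv /= => /andP[? ?].
    by apply/andP; split; lra.
  have [|d d0 xd] := gap x; first by split=> // /mem_set.
  (* The bound [d] keeps points of [K] from lying left of [x]; the bound [e] keeps them below
     [x + e]. *)
  exists (Num.min d e) => [|z [+ Kz]]; first by rewrite lt_min d0.
  rewrite /ball /= lt_min !ltr_norml => /andP[/andP[? ?] /andP[? ?]].
  rewrite in_itv /=; apply/andP; split; last lra.
  rewrite leNgt; apply/negP => zx.
  suff : ([set` `]x - d, x[] `&` K) z by rewrite xd.
  by split=> //=; rewrite in_itv /= zx andbT; lra.
(* Intersecting [U] with [K], which belongs to [F], puts the common point in [K], where the ball
   lies inside the Hattori neighbourhood. *)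
have [z [[Uz Kz] xz]] := clx _ _ (filterI FU FK) (nbhsx_ballx x d d0).
by exists z; split=> //; apply/eV/dV.
Qed.

Theorem proposition2 (R : realType) (A K : set R)
    (K_infinite : ([set: nat] #<= K)%card) :
  compact (K : set (hattori A)) <->
  [/\ compact (K : set R),
      countable (K `\` A) &
      forall x : R, (K `\` A) x ->
        exists2 e : R, 0 < e & [set` `]x - e, x[] `&` K = set0].
Proof.
split=> [cK|[cK _ gap]]; last exact: compact_left_gap_hattori_compact.
have gap := fun x => @hattori_compact_left_gap R A K x cK.
split=> //; first exact: hattori_compact_compact cK.
apply: left_isolated_countable => x /gap[e e0 xe]; exists e => //.
(* A gap of [K] is also a gap of its subset [K \ A]. *)
by rewrite setIDA xe set0D.
Qed.
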